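(* Let $d\ge 2$, $0<r<1$, $\rho>0$, let $\mu$ be the uniform probability measure on $S^{d-1}\subset\mathbb{R}^d$, and $k(x,y)=\mathbf 1(\|x-y\|\le r)$. Let $e_1,\dots,e_d$ be the standard basis of $\mathbb{R}^d$. For each $i$, let $v_i:S^{d-1}\to[0,1]$ be the unique measurable map with $v_i=1$ on $M^s_i=\{y\in S^{d-1}:\|y-e_i\|\le r\}$ and, for $x\notin M^s_i$, $$v_i(x)=\frac{\int_{M^s_i}k(x,y)d\mu(y)+\int_{S^{d-1}\setminus M^s_i}v_i(y)k(x,y)d\mu(y)}{\rho+\int_{S^{d-1}}k(x,y)d\mu(y)}.$$ Let $r'\in[0,\pi]$ be the angle subtending a chord of length $r$ on the unit circle. Then the map $F:S^{d-1}\to\mathbb{R}^d$, $F(x)=(v_1(x),\dots,v_d(x))$, is $r'\sqrt d$-injective: for all $x,x'\in S^{d-1}$ with $\|x-x'\|>r'\sqrt d$, we have $F(x)\neq F(x')$.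
   Context: A map $f:X\to Z$ between metric spaces is $\epsilon$-injective if $d(x,x')>\epsilon$ implies $f(x)\neq f(x')$; here $S^{d-1}$ carries the Euclidean ($\ell_2$) distance of $\mathbb{R}^d$. *)

(* Defs.v *)
From HB Require Import structures.
From mathcomp Require Import all_boot all_order all_algebra.
From mathcomp Require Import all_classical all_reals all_analysis.
Set Implicit Arguments. Unset Strict Implicit. Unset Printing Implicit Defensive.
Import Order.TTheory GRing.Theory Num.Theory.
Import numFieldNormedType.Exports.
Local Open Scope ring_scope.
Local Open Scope classical_set_scope.

Definition Rd (R : realType) (d : nat) :=
  g_sigma_algebraType (fun A : set 'M[R]_(1, d) => open A).

Definition enorm (R : realType) (d : nat) (x : 'M[R]_(1, d)) : R :=
  Num.sqrt (\sum_(i < d) x 0 i ^+ 2).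

Definition sphere (R : realType) (d : nat) : set (Rd R d) :=
  [set x | enorm x = 1].
Arguments sphere : clear implicits.

(* mu is the uniform probability measure on S^{d-1}: a probability measure
   on the Borel sets of R^d, concentrated on the sphere, and invariant under
   every orthogonal linear map (the normalized rotation-invariant measure). *)
Definition uniform_sphere (R : realType) (d : nat)
    (mu : probability (Rd R d) R) : Prop :=
  mu (~` (sphere R d)) = 0%E /\
  forall Q : 'M[R]_d, Q *m Q^T = 1%:M ->
    forall A : set (Rd R d), measurable A ->
      mu ((fun x : Rd R d => x *m Q) @^-1` A) = mu A.

Definition kern (R : realType) (d : nat) (r : R) (x y : Rd R d) : R :=
  if enorm (x - y) <= r then 1 else 0.

Definition ebasis (R : realType) (d : nat) (i : 'I_d) : 'M[R]_(1, d) :=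
  delta_mx 0 i.

Definition Ms (R : realType) (d : nat) (r : R) (i : 'I_d) : set (Rd R d) :=
  [set y | sphere R d y /\ enorm (y - ebasis R i) <= r].

(* the angle r' in [0, pi] subtending a chord of length r on the unit circle *)
Definition chord_angle (R : realType) (r : R) : R := 2 * asin (r / 2).

(* Main.v *)
(* Once v_i is known to be monotone in the i-th coordinate and positive, a gap
   [x 0 i - x' 0 i > r] puts the whole r-neighbourhood of x' where v_i <= v_i x,
   so v_i x' <= D / (rho + D) * v_i x < v_i x, where D is the integral of
   k(x', .), which does not depend on x'. Since r <= r', points with equal images
   have all coordinates within r', hence lie at distance at most r' * sqrt d.

   Monotonicity is a maximum principle. Let M be the supremum of v_i x' - v_i x
   over the pairs with [x' 0 i <= x 0 i], and let sigma be the reflection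
   exchanging x and x'. Averaging the equation over sigma (two-point
   symmetrization) gives, for x and x' outside the landmark ball,
     2 (rho + D) (v_i x' - v_i x)
       = int (v_i y - v_i (sigma y)) (k(x',y) - k(x,y)) dmu(y) <= 2 M D,
   because the mirror determines both the sign of k(x',y) - k(x,y) and which of
   y, sigma y is higher. Hence M <= M D / (rho + D), that is, M <= 0.

   Positivity: if v_i x = 0, then v_i vanishes almost everywhere on the r-ball
   around x and, by monotonicity, around every point at the height of x. One such
   ball contains a cap whose points are all higher than x by a fixed amount; as
   caps have positive measure, the zeros of v_i have no highest level. *)

Require Import Defs.
From HB Require Import structures.
From mathcomp Require Import all_boot all_order all_algebra.
From mathcomp Require Import all_classical all_reals all_analysis.
From mathcomp Require Import measurable_realfun.
From mathcomp Require Import ring lra.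
Import Order.TTheory GRing.Theory Num.Theory.
Import numFieldNormedType.Exports.
Local Open Scope ring_scope.
Local Open Scope classical_set_scope.

(** * Euclidean geometry of row vectors *)

Section euclidean.
Context {R : realType} {d : nat}.
Implicit Types x y z u : 'M[R]_(1, d).

Definition dot x y : R := (x *m y^T) 0 0.

Lemma dotE x y : dot x y = \sum_(i < d) x 0 i * y 0 i.
Proof. by rewrite /dot mxE; apply: eq_bigr => i _; rewrite mxE. Qed.

Lemma dotC x y : dot x y = dot y x.
Proof. by rewrite !dotE; apply: eq_bigr => i _; rewrite mulrC. Qed.

Lemma dotDl x y z : dot (x + y) z = dot x z + dot y z.
Proof. by rewrite /dot mulmxDl mxE. Qed.

Lemma dotNl x y : dot (- x) y = - dot x y.
Proof. by rewrite /dot mulNmx mxE. Qed.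

Lemma dotBl x y z : dot (x - y) z = dot x z - dot y z.
Proof. by rewrite dotDl dotNl. Qed.

Lemma dotZl a x y : dot (a *: x) y = a * dot x y.
Proof. by rewrite /dot -scalemxAl mxE. Qed.

Lemma dotDr x y z : dot x (y + z) = dot x y + dot x z.
Proof. by rewrite !(dotC x) dotDl. Qed.

Lemma dotBr x y z : dot x (y - z) = dot x y - dot x z.
Proof. by rewrite !(dotC x) dotBl. Qed.

Lemma dotZr a x y : dot x (a *: y) = a * dot x y.
Proof. by rewrite !(dotC x) dotZl. Qed.

Lemma dot_ge0 x : 0 <= dot x x.
Proof. by rewrite dotE sumr_ge0// => i _; rewrite -expr2 sqr_ge0. Qed.

Lemma dot_eq0 x : (dot x x == 0) = (x == 0).
Proof.
apply/idP/eqP => [|->]; last by rewrite /dot mul0mx mxE.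
rewrite dotE psumr_eq0 => [/allP x0|i _]; last by rewrite -expr2 sqr_ge0.
apply/rowP => i; rewrite mxE; apply/eqP.
by have := x0 i (mem_index_enum i); rewrite /= mulf_eq0 orbb.
Qed.

Lemma enormE x : enorm x = Num.sqrt (dot x x).
Proof. by rewrite /enorm dotE; congr Num.sqrt; apply: eq_bigr => i _; rewrite expr2. Qed.

Lemma enorm_ge0 x : 0 <= enorm x.
Proof. by rewrite enormE sqrtr_ge0. Qed.

Lemma sqr_enorm x : enorm x ^+ 2 = dot x x.
Proof. by rewrite enormE sqr_sqrtr// dot_ge0. Qed.

Lemma enorm_le x a : 0 <= a -> (enorm x <= a) = (dot x x <= a ^+ 2).
Proof. by move=> a0; rewrite -sqr_enorm ler_pXn2r// nnegrE enorm_ge0. Qed.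

Lemma sphereP x : sphere R d x <-> dot x x = 1.
Proof.
rewrite /sphere/= -sqr_enorm; split=> [->|/eqP]; first by rewrite expr1n.
by rewrite sqrf_eq1 => /orP[/eqP//|/eqP n];
  have := enorm_ge0 x; rewrite n lerNr oppr0 ler10.
Qed.

Lemma cauchy_schwarz x y : dot x y ^+ 2 <= dot x x * dot y y.
Proof.
have [->|y0] := eqVneq y 0.
  by rewrite [dot x 0]dotC /dot !mul0mx mxE expr0n mulr0.
have yy : 0 < dot y y by rewrite lt_def dot_eq0 y0 dot_ge0.
have := dot_ge0 (dot y y *: x - dot x y *: y).
rewrite !(dotBl, dotBr, dotZl, dotZr) (dotC y x).
rewrite (_ : _ - _ = dot y y * (dot x x * dot y y - dot x y ^+ 2)); last by ring.
by rewrite pmulr_rge0// subr_ge0.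
Qed.

Lemma enorm_triangle x y : enorm (x + y) <= enorm x + enorm y.
Proof.
rewrite enorm_le ?addr_ge0 ?enorm_ge0//.
rewrite dotDl !dotDr (dotC y x) sqrrD !sqr_enorm.
have : dot x y <= enorm x * enorm y.
  apply: le_trans (ler_norm _) _.
  rewrite -(ler_pXn2r (ltn0Sn 1)) ?nnegrE ?mulr_ge0 ?enorm_ge0//.
  by rewrite real_normK ?num_real// exprMn !sqr_enorm cauchy_schwarz.
by lra.
Qed.

Lemma enormB x y : enorm (x - y) = enorm (y - x).
Proof. by rewrite !enormE -(opprB x) !dotNl (dotC _ (- _)) !dotNl opprK. Qed.

Lemma coordB x y i : (x - y) 0 i = x 0 i - y 0 i.
Proof. by rewrite !mxE. Qed.

Lemma coord_le_enorm x i : `|x 0 i| <= enorm x.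
Proof.
rewrite -(ler_pXn2r (ltn0Sn 1)) ?nnegrE ?enorm_ge0//.
rewrite real_normK ?num_real// sqr_enorm dotE (bigD1 i)//= -expr2.
by rewrite lerDl sumr_ge0// => j _; rewrite -expr2 sqr_ge0.
Qed.

Lemma enorm_le_coord x a : (forall i, `|x 0 i| <= a) ->
  enorm x <= a * Num.sqrt d%:R.
Proof.
(* The sign of [a] is read off some coordinate. For [d = 0] there is none and [a] may be negative,
   but both sides are then 0. *)
have [->|/rV0Pn[j _]] := eqVneq x 0.
  have -> : enorm (0 : 'M[R]_(1, d)) = 0 by rewrite enormE /dot mul0mx mxE sqrtr0.
  case: (posnP d) => [->|d0 xa]; first by rewrite sqrtr0 mulr0.
  rewrite mulr_ge0 ?sqrtr_ge0// (le_trans _ (xa (Ordinal d0)))//.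
move=> xa; have a0 : 0 <= a by exact: le_trans (xa j).
rewrite enorm_le ?mulr_ge0 ?sqrtr_ge0// exprMn sqr_sqrtr//.
rewrite dotE mulr_natr -[X in _ *+ X](card_ord d) -sumr_const ler_sum// => i _.
by rewrite -expr2 -real_normK ?num_real// ler_pXn2r ?nnegrE.
Qed.

Lemma dot_ebasis x i : dot x (ebasis R i) = x 0 i.
Proof.
rewrite dotE (bigD1 i)//= big1 => [|j ji]; first by rewrite mxE !eqxx mulr1 addr0.
by rewrite mxE (negbTE ji) mulr0.
Qed.

(** The Householder matrix of the hyperplane orthogonal to [u]; it is symmetric and acts on row
    vectors from the right. *)
Definition reflection u : 'M[R]_d := 1%:M - (2 / dot u u) *: (u^T *m u).

Lemma reflectionE u y :
  y *m reflection u = y - (2 * dot y u / dot u u) *: u.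
Proof.
rewrite /reflection mulmxBr mulmx1 -scalemxAr mulmxA.
rewrite [y *m u^T]mx11_scalar -/(dot y u) mul_scalar_mx scalerA.
by congr (_ - _ *: _); ring.
Qed.

Lemma reflectionK u y : u != 0 -> y *m reflection u *m reflection u = y.
Proof.
rewrite -dot_eq0 => u0.
rewrite 2!reflectionE dotBl dotZl -addrA -opprD -scalerDl.
by rewrite [X in X *: _](_ : _ = 0) ?scale0r ?subr0//; field.
Qed.

Lemma reflection_orthogonal u : u != 0 ->
  reflection u *m (reflection u)^T = 1%:M.
Proof.
move=> u0.
have -> : (reflection u)^T = reflection u.
  by rewrite /reflection linearB/= trmx1 linearZ/= trmx_mul trmxK.
by apply/row_matrixP => i; rewrite row_mul !rowE reflectionK// mulmx1.
Qed.

Lemma dot_mulmx (Q : 'M[R]_d) x y : Q *m Q^T = 1%:M ->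
  dot (x *m Q) (y *m Q) = dot x y.
Proof. by move=> QQ; rewrite /dot trmx_mul mulmxA -(mulmxA x) QQ mulmx1. Qed.

Lemma enorm_mulmxB (Q : 'M[R]_d) x y : Q *m Q^T = 1%:M ->
  enorm (x *m Q - y *m Q) = enorm (x - y).
Proof. by move=> QQ; rewrite -mulmxBl !enormE dot_mulmx. Qed.

(** For equal lengths, [2 * dot x (x - x')] is the squared length of [x - x'], so the reflection
    subtracts exactly [x - x'] from [x]. *)
Lemma reflection_swap x x' : dot x x = dot x' x' -> x != x' ->
  x *m reflection (x - x') = x'.
Proof.
move=> xx; rewrite -subr_eq0 -dot_eq0 => u0; rewrite reflectionE.
have -> : 2 * dot x (x - x') / dot (x - x') (x - x') = 1.
  apply: (mulIf u0); rewrite mul1r divfK//.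
  by rewrite !(dotBl, dotBr) -xx (dotC x' x); ring.
by rewrite scale1r opprB addrC subrK.
Qed.

End euclidean.

(** * Comparison of a chord with its angle *)

Lemma sin_le_id {R : realType} (a : R) : 0 <= a -> sin a <= a.
Proof.
move=> a0.
have csin : {within `[0, a], continuous (@sin R)}.
  by apply: continuous_subspaceT => c; exact: continuous_sin.
have [c _] := @MVT_segment R sin cos 0 a a0 (fun c _ => is_derive_sin c) csin.
rewrite sin0 !subr0 => ->.
by rewrite ler_piMl// cos_le1.
Qed.

(** With [a = asin (r / 2)], one has [r = 2 * sin a <= 2 * a] as soon as [a >= 0]. *)
Lemma chord_angle_ge {R : realType} (r : R) : 0 < r -> r < 1 -> r <= chord_angle r.
Proof.
move=> r0 r1; rewrite /chord_angle.
have r2 : -1 <= r / 2 <= 1 by apply/andP; split; lra.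
have [] := asin_def r2; set a := asin _ => /andP[a1 a2] sina.
suff a0 : 0 <= a by have := sin_le_id _ a0; lra.
rewrite leNgt; apply/negP => a0.
have : 0 < sin (- a).
  by apply: sin_gt0_pi; apply/andP; split; have := pi_gt0 R; lra.
by rewrite sinN sina; lra.
Qed.

(** * The uniform measure on the sphere *)

Section borel.
Context {R : realType} {d : nat}.

Lemma mulmx_continuous (Q : 'M[R]_d) :
  continuous (fun y : 'M[R]_(1, d) => y *m Q).
Proof.
(* A neighbourhood of a matrix contains a product of neighbourhoods [P i j] of its entries, so
   continuity is checked entry by entry. *)
move=> y A [P PA sPA].
have cPij i j : nbhs y [set z | P i j ((z *m Q) i j)].
  have : continuous (fun z : 'M[R]_(1, d) => (z *m Q) i j).
    have -> : (fun z : 'M[R]_(1, d) => (z *m Q) i j) =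
              (fun z => \sum_k z i k * Q k j).
      by apply/funext => z; rewrite mxE.
    apply: continuous_big => [|k _ z]; first exact: add_continuous.
    exact: (cvgM (@coord_continuous R 1 d i k z) (cvg_cst _)).
  by apply; exact: PA.
apply: (@filterS _ (nbhs y) _ [set z | forall i j, P i j ((z *m Q) i j)]).
  by move=> z; exact: sPA.
have cPi i : nbhs y [set z | forall j, P i j ((z *m Q) i j)].
  exact: (@filter_forall _ _ (fun j z => P i j ((z *m Q) i j))
  (nbhs y) (nbhs_filter y) (cPij i)).
exact: (@filter_forall _ _ (fun i z => forall j, P i j ((z *m Q) i j))
  (nbhs y) (nbhs_filter y) cPi).
Qed.

Lemma measurable_mulmx (Q : 'M[R]_d) :
  measurable_fun setT ((fun y => y *m Q) : Rd R d -> Rd R d).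
Proof.
apply: (@measurability _ _ (Rd R d) (Rd R d) setT _ (fun A => open A)) => //.
move=> _ [A oA <-]; rewrite setTI; apply: sub_sigma_algebra.
by apply: open_comp => // y _; exact: mulmx_continuous.
Qed.

Lemma measurable_coord i : measurable_fun setT ((fun y => y 0 i) : Rd R d -> R).
Proof.
apply: (@measurability _ _ _ _ _ _ _ (RGenOInfty.measurableE R)).
move=> _ [_ [a ->] <-]; rewrite setTI; apply: sub_sigma_algebra.
apply: open_comp; last exact: rray_open.
by move=> y _; exact: coord_continuous.
Qed.

Lemma measurable_enormB x :
  measurable_fun setT ((fun y => enorm (x - y)) : Rd R d -> R).
Proof.
apply: (@measurableT_comp _ _ _ _ _ _ (@Num.sqrt R)).
  exact: (continuous_measurable_fun (@sqrt_continuous R)).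
apply: measurable_sum => i.
apply: measurable_funX.
rewrite (_ : (fun _ => _) = (fun y : Rd R d => x 0 i - y 0 i)).
  by apply: measurable_funB => //; exact: measurable_coord.
by apply/funext => y; rewrite !mxE.
Qed.

Lemma measurable_kern (r : R) (x : Rd R d) : measurable_fun setT (kern r x).
Proof.
apply: measurable_fun_ifT => //; apply: measurable_fun_ler => //.
exact: measurable_enormB.
Qed.

Lemma measurable_enorm :
  measurable_fun setT ((fun y => enorm y) : Rd R d -> R).
Proof.
apply: eq_measurable_fun (measurable_enormB 0) => y _.
by rewrite sub0r !enormE dotNl dotC dotNl opprK.
Qed.

Lemma measurable_sphere : measurable (sphere R d).
Proof.
rewrite (_ : sphere R d = setT `&` ((fun y : Rd R d => enorm y) @^-1` [set 1])).
  exact: measurable_enorm.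
by rewrite setTI.
Qed.

Lemma measurable_eball (x : Rd R d) r : measurable [set y : Rd R d | enorm (x - y) <= r].
Proof.
rewrite (_ : [set _ | _] = setT `&` ((fun y : Rd R d => enorm (x - y)) @^-1` `]-oo, r])).
  exact: measurable_enormB.
by rewrite setTI; apply/seteqP; split=> y /=; rewrite in_itv.
Qed.

Lemma measurable_Ms r i : measurable (Ms (R := R) (d := d) r i).
Proof.
rewrite (_ : Ms r i = sphere R d `&` [set y | enorm (ebasis R i - y) <= r]).
  by apply: measurableI; [exact: measurable_sphere|exact: measurable_eball].
by apply/seteqP; split => y; rewrite /Ms/= enormB.
Qed.

End borel.

Lemma bounded_integrable {R : realType} {disp} {T : measurableType disp}
    (mu : probability T R) (f : T -> R) (M : R) :
  measurable_fun setT f -> (forall y, `|f y| <= M) ->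
  mu.-integrable setT (EFin \o f).
Proof.
move=> mf fM; apply: measurable_bounded_integrable => //.
  by rewrite -ge0_fin_numE// fin_num_measure.
exists M; split; first exact: num_real.
by move=> N MN y _; exact: le_trans (fM y) (ltW MN).
Qed.

Section uniform.
Context {R : realType} {d : nat} (mu : probability (Rd R d) R).
Hypothesis mu_uniform : uniform_sphere mu.

(** Change of variables: [uniform_sphere] says that the pushforward of [mu] under [Q] is [mu], and
    the bound [M] makes [f] integrable. *)
Lemma Rintegral_mulmx (Q : 'M[R]_d) (f : Rd R d -> R) (M : R) :
  Q *m Q^T = 1%:M -> measurable_fun setT f -> (forall y, `|f y| <= M) ->
  Rintegral mu setT (fun y => f (y *m Q)) = Rintegral mu setT f.
Proof.
move=> QQ mf fM; congr fine.
have mQ := measurable_mulmx Q.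
transitivity (\int[pushforward mu (fun y : Rd R d => y *m Q : Rd R d)]_(y in setT) (f y)%:E)%E.
  rewrite (integral_pushforward mQ) ?preimage_setT//.
    exact/measurable_EFinP.
  apply: (@bounded_integrable _ _ _ mu (fun y => f (y *m Q)) M) => //.
  exact: (measurableT_comp mf mQ).
by apply: eq_measure_integral => A mA _; exact: mu_uniform.2.
Qed.

End uniform.

(** * The kernel and the landmark ball on the sphere *)

Section kernel.
Context {R : realType} {d : nat} (r : R).
Implicit Types x y : Rd R d.

(** The cutoff turns integrals over the sphere into integrals over the whole space, the form to
    which [Rintegral_mulmx] applies. *)
Definition skern x : Rd R d -> R := kern r x \_ (sphere R d).

Lemma skernE x y : sphere R d y -> skern x y = kern r x y.
Proof. by move=> Sy; rewrite /skern patchE mem_set. Qed.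

Lemma skern_out x y : ~ sphere R d y -> skern x y = 0.
Proof. by move=> Sy; rewrite /skern patchE memNset. Qed.

Lemma skern_ge0 x y : 0 <= skern x y.
Proof. by rewrite /skern patchE /kern; case: ifP => // _; case: ifP. Qed.

Lemma skern_le1 x y : skern x y <= 1.
Proof. by rewrite /skern patchE /kern; case: ifP => // _; case: ifP. Qed.

Lemma normr_skern x y : `|skern x y| <= 1.
Proof. by rewrite ger0_norm ?skern_ge0 ?skern_le1. Qed.

Lemma measurable_skern x : measurable_fun setT (skern x).
Proof.
apply/(measurable_restrictT _ measurable_sphere).
by apply: measurable_funTS; exact: measurable_kern.
Qed.

Lemma sphere_mulmx (Q : 'M[R]_d) y : Q *m Q^T = 1%:M ->
  sphere R d (y *m Q) <-> sphere R d y.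
Proof. by move=> QQ; rewrite !sphereP dot_mulmx. Qed.

Lemma skern_mulmx (Q : 'M[R]_d) x y : Q *m Q^T = 1%:M ->
  skern (x *m Q) (y *m Q) = skern x y.
Proof.
move=> QQ; have [Sy|Sy] := pselect (sphere R d y).
  by rewrite !skernE ?sphere_mulmx// /kern enorm_mulmxB.
by rewrite !skern_out ?sphere_mulmx.
Qed.

Lemma sqr_enormB_sphere x y : sphere R d x -> sphere R d y ->
  enorm (x - y) ^+ 2 = 2 - 2 * dot x y.
Proof.
move=> /sphereP x1 /sphereP y1.
by rewrite sqr_enorm !(dotBl, dotBr) x1 y1 (dotC y x); ring.
Qed.

Lemma enormB_le_sphere x y a : 0 <= a -> sphere R d x -> sphere R d y ->
  (enorm (x - y) <= a) = (2 - 2 * dot x y <= a ^+ 2).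
Proof. by move=> a0 Sx Sy; rewrite -sqr_enormB_sphere// ler_pXn2r ?nnegrE ?enorm_ge0. Qed.

(** Between unit vectors the distance decreases as the inner product grows. *)
Lemma kern_mono x x' y : 0 <= r -> sphere R d x -> sphere R d x' ->
  sphere R d y -> dot x' y <= dot x y -> kern r x' y <= kern r x y.
Proof.
move=> r0 Sx Sx' Sy xy; rewrite /kern !enormB_le_sphere//.
by case: ifP => [h|_]; [rewrite ifT//; lra|case: ifP].
Qed.

Lemma sphere_ebasis i : sphere R d (ebasis R i).
Proof. by apply/sphereP; rewrite dot_ebasis mxE !eqxx. Qed.

Lemma MsE i x : 0 <= r -> Ms r i x <-> sphere R d x /\ 2 - 2 * x 0 i <= r ^+ 2.
Proof.
move=> r0; have Se := sphere_ebasis i.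
by rewrite /Ms/=; split=> -[Sx]; rewrite enormB_le_sphere// dot_ebasis.
Qed.

Lemma coord_sphere_itv (x : Rd R d) k : sphere R d x -> -1 <= x 0 k <= 1.
Proof. by move=> Sx; have := coord_le_enorm x k; rewrite Sx ler_norml. Qed.

End kernel.

(** * A meridian parametrized by height *)

Section parallel.
Context {R : realType} {d : nat} (i j : 'I_d).
Hypothesis ij : j != i.

(** For [-1 <= t <= 1], a representative of the height [t], on the half great circle through
    [ebasis R j] that joins the poles of axis [i]. *)
Definition parallel_point (t : R) : Rd R d :=
  t *: ebasis R i + Num.sqrt (1 - t ^+ 2) *: ebasis R j.

Lemma dot_parallel_point s t : dot (parallel_point s) (parallel_point t) =
  s * t + Num.sqrt (1 - s ^+ 2) * Num.sqrt (1 - t ^+ 2).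
Proof.
rewrite !(dotDl, dotDr, dotZl, dotZr, dot_ebasis) !mxE !eqxx /=.
by rewrite (negbTE ij) eq_sym (negbTE ij) /=; ring.
Qed.

Lemma sphere_parallel_point t : -1 <= t <= 1 -> sphere R d (parallel_point t).
Proof.
move=> t1; apply/sphereP; rewrite dot_parallel_point -!expr2 sqr_sqrtr; last by nra.
by ring.
Qed.

Lemma parallel_point_coord t : parallel_point t 0 i = t.
Proof. by rewrite !mxE !eqxx eq_sym (negbTE ij) /= mulr1 mulr0 addr0. Qed.

(* [(sqrt A - sqrt B)^2 <= |A - B|] gives a bound linear in [t - s] up to the poles. *)
Lemma parallel_point_dist s t : -1 <= s -> s <= t -> t <= 1 ->
  enorm (parallel_point s - parallel_point t) ^+ 2 <= 4 * (t - s).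
Proof.
move=> s1 st t1.
rewrite sqr_enormB_sphere; try by apply: sphere_parallel_point; apply/andP; split; lra.
rewrite dot_parallel_point.
have hs : 0 <= 1 - s ^+ 2 by nra.
have ht : 0 <= 1 - t ^+ 2 by nra.
have := sqr_sqrtr hs; have := sqr_sqrtr ht.
have := sqrtr_ge0 (1 - s ^+ 2); have := sqrtr_ge0 (1 - t ^+ 2).
set A := Num.sqrt (1 - s ^+ 2); set B := Num.sqrt (1 - t ^+ 2) => B0 A0 BE AE.
have : (A - B) ^+ 2 <= 2 * (t - s).
  have [AB|BA] := leP B A.
    have : (A - B) ^+ 2 <= (A - B) * (A + B) by nra.
    by nra.
  have : (A - B) ^+ 2 <= (B - A) * (A + B) by nra.
  by nra.
by nra.
Qed.

End parallel.

(** * Spherical caps have positive measure *)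

Section balls.
Context {R : realType} {d : nat} (mu : probability (Rd R d) R).
Hypothesis mu_uniform : uniform_sphere mu.

Definition cap (c : Rd R d) (e : R) : set (Rd R d) :=
  sphere R d `&` [set y | enorm (c - y) <= e].

Lemma measurable_cap c e : measurable (cap c e).
Proof. by apply: measurableI; [exact: measurable_sphere|exact: measurable_eball]. Qed.

(** The reflection exchanging the two centres carries one cap onto the other. *)
Lemma cap_measure_eq c c' e : sphere R d c -> sphere R d c' ->
  mu (cap c e) = mu (cap c' e).
Proof.
move=> Sc Sc'; have [->//|cc'] := eqVneq c c'.
have QQ : reflection (c - c') *m (reflection (c - c'))^T = 1%:M.
  by apply: reflection_orthogonal; rewrite subr_eq0.
rewrite -[RHS](mu_uniform.2 _ QQ _ (measurable_cap _ _)).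
congr (mu _); apply/seteqP; rewrite /cap.
have cQ : c *m reflection (c - c') = c'.
  by apply: reflection_swap => //; rewrite !(sphereP _).1.
split=> y; rewrite /preimage/= -{2}cQ enorm_mulmxB//.
  by move=> [Sy ?]; split => //; apply/sphere_mulmx.
by move=> [Sy ?]; split => //; apply/(sphere_mulmx _ _ QQ).
Qed.

(** If one cap were null, all caps of radius [e] would be, hence also the sphere, against the total
    mass 1. *)
Lemma cap_gt0 c e : sphere R d c -> 0 < e -> (0 < mu (cap c e))%E.
Proof.
move=> Sc e0; rewrite lt_neqAle measure_ge0 andbT eq_sym; apply/eqP => mu0.
have capN c' : sphere R d c' -> mu.-negligible (cap c' e).
  by move=> Sc'; apply/(negligibleP _ (measurable_cap _ _));
    exact: etrans (cap_measure_eq _ _ e Sc' Sc) mu0.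
have sd1 : 0 < Num.sqrt d%:R + 1 :> R by rewrite ltr_wpDl// sqrtr_ge0.
(* A cube of side [dl] has diameter at most [e]; the [+ 1] in the witness keeps its denominator
   positive for every [d]. *)
have [dl [dl0 dle]] : exists dl : R, 0 < dl /\ dl * Num.sqrt d%:R <= e.
  exists (e / (Num.sqrt d%:R + 1)); split; first by rewrite divr_gt0.
  by rewrite mulrAC ler_pdivrMr// ler_pM2l// lerDl.
(* Countably many cubes cover the sphere, and each lies in a null cap. *)
pose cube (f : {ffun 'I_d -> int}) : set (Rd R d) :=
  sphere R d `&` [set y | forall j, Num.floor (y 0 j / dl) = f j].
have cubeN f : mu.-negligible (cube f).
  have [->|/set0P[c' [Sc' fc']]] := eqVneq (cube f) set0.
    exact: negligible_set0.
  apply: (negligibleS _ (capN c' Sc')) => y [Sy fy]; split=> //=.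
  apply: le_trans dle; apply: enorm_le_coord => j; rewrite !mxE.
    have := floor_itv (y 0 j / dl); have := floor_itv (c' 0 j / dl).
    rewrite fy fc' => /andP[c1 c2] /andP[y1 y2].
    move: c1 c2 y1 y2; rewrite intrD !ler_pdivlMr// !ltr_pdivrMr// => c1 c2 y1 y2.
        by rewrite ler_norml; apply/andP; split; lra.
pose F n := if unpickle n is Some f then cube f else set0.
have FN : mu.-negligible (\bigcup_n F n).
  apply: negligible_bigcup => n; rewrite /F; case: unpickle => [f|]; first exact: cubeN.
  exact: negligible_set0.
have SN : mu.-negligible (~` (sphere R d)).
  by apply/negligibleP; [apply: measurableC; exact: measurable_sphere|exact: mu_uniform.1].
have : mu.-negligible [set: Rd R d].
  apply: (negligibleS _ (negligibleU SN FN)) => y _.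
  have [Sy|Sy] := pselect (sphere R d y); [right|by left].
  pose f := [ffun j => Num.floor (y 0 j / dl)].
  exists (pickle f) => //; rewrite /F pickleK; split=> // j.
  by rewrite ffunE.
move=> /(negligibleP _ measurableT) muT.
have /eqP := etrans (esym muT) (probability_setT mu).
by rewrite eq_sym onee_eq0.
Qed.

End balls.

(** * The absorption probability of one landmark *)

Section landmark.
Context {R : realType} {d : nat} (mu : probability (Rd R d) R) (r rho : R).
Hypothesis mu_uniform : uniform_sphere mu.
Hypotheses (r0 : 0 < r) (rho0 : 0 < rho).
Context (i : 'I_d) (v : Rd R d -> R).
Hypothesis mv : measurable_fun (sphere R d) v.
Hypothesis v01 : forall x, sphere R d x -> 0 <= v x <= 1.
Hypothesis v1 : forall x, Ms r i x -> v x = 1.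
Hypothesis veq : forall x, sphere R d x -> ~ Ms r i x ->
  v x = (Rintegral mu (Ms r i) (fun y => kern r x y)
         + Rintegral mu (sphere R d `\` Ms r i) (fun y => v y * kern r x y))
        / (rho + Rintegral mu (sphere R d) (fun y => kern r x y)).

Definition degree (x : Rd R d) : R := Rintegral mu setT (skern r x).
Definition avg (x : Rd R d) : R := Rintegral mu setT (fun y => v y * skern r x y).

(** [v] is controlled on the sphere only; seen as a restriction to it, the product is measurable
    everywhere. *)
Lemma skernM x : (fun y => v y * skern r x y) =
  (fun y => v y * kern r x y) \_ (sphere R d).
Proof.
apply/funext => y; rewrite patchE; case: ifPn => [/set_mem|/negP] Sy.
  by rewrite skernE.
by rewrite skern_out ?mulr0// => /mem_set.
Qed.

Lemma measurable_vskern x : measurable_fun setT (fun y => v y * skern r x y).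
Proof.
rewrite skernM.
apply/(measurable_restrictT _ measurable_sphere).
apply: measurable_funM => //.
by apply: measurable_funTS; exact: measurable_kern.
Qed.

Lemma normr_vskern x y : `|v y * skern r x y| <= 1.
Proof.
have [Sy|Sy] := pselect (sphere R d y); last by rewrite skern_out// mulr0 normr0.
rewrite normrM mulr_ile1 ?normr_skern//.
by have /andP[v0 v1'] := v01 _ Sy; rewrite ger0_norm.
Qed.

Let int_vskern x : mu.-integrable setT (EFin \o (fun y => v y * skern r x y)).
Proof. exact: bounded_integrable (measurable_vskern x) (normr_vskern x). Qed.

Let int_skern x : mu.-integrable setT (EFin \o skern r x).
Proof. exact: bounded_integrable (measurable_skern r x) (normr_skern r x). Qed.

Let degree_ge0 x : 0 <= degree x.
Proof. by apply: Rintegral_ge0 => y _; exact: skern_ge0. Qed.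

Let degree_le1 x : degree x <= 1.
Proof.
have int1 : mu.-integrable setT (EFin \o (fun _ : Rd R d => 1 : R)).
  by apply: (@bounded_integrable _ _ _ mu (fun=> 1) 1) => // y; rewrite normr1.
have := le_Rintegral measurableT (int_skern x) int1 (fun y _ => skern_le1 r x y).
rewrite Rintegral_cst// => /le_trans; apply.
by rewrite [X in fine X](_ : _ = 1%E) ?mul1r//; exact: probability_setT.
Qed.

(** Since [v = 1] on the landmark ball, a factor [v y] can be inserted in the first integral, and
    the two domains join into the sphere. *)
Lemma landmark_eq x : sphere R d x -> ~ Ms r i x -> v x = avg x / (rho + degree x).
Proof.
move=> Sx Mx; rewrite veq// -/(skern r x) [in RHS]/degree /skern -Rintegral_mkcond.
congr (_ / _).
rewrite /avg skernM -Rintegral_mkcond.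
have MS : Ms r i `<=` sphere R d by move=> y [].
rewrite -{2}(setDUK MS) Rintegral_setU; first last.
- by apply/disj_setPS => y [My []].
- rewrite setDUK//; apply/integrable_mkcond; first exact: measurable_sphere.
  by move: (int_vskern x); rewrite skernM -restrict_EFin.
- by apply: measurableD; [exact: measurable_sphere|exact: measurable_Ms].
- exact: measurable_Ms.
congr (_ + _); apply: eq_Rintegral => y /set_mem My.
by rewrite v1// mul1r.
Qed.

Lemma degree_mulmx (Q : 'M[R]_d) x : Q *m Q^T = 1%:M -> degree (x *m Q) = degree x.
Proof.
move=> QQ.
rewrite /degree.
rewrite -(Rintegral_mulmx _ mu_uniform _ _ _ QQ (measurable_skern _ _) (normr_skern _ _)).
by apply: eq_Rintegral => y _; rewrite skern_mulmx.
Qed.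


(** If [y] lies on the side of [x] of the mirror, it is no farther from [x] than from [x'] and no
    lower than its image [y'], so [v y' - v y <= M]. On the other side both comparisons are
    reversed. *)
Lemma two_point (M : R) (x x' y y' : Rd R d) : 0 <= M ->
  (forall z z', sphere R d z -> sphere R d z' -> z' 0 i <= z 0 i ->
     v z' - v z <= M) ->
  sphere R d x -> sphere R d x' -> x != x' -> x' 0 i <= x 0 i ->
  y' = y *m reflection (x - x') ->
  (v y - v y') * (skern r x' y - skern r x y) <= M * (skern r x y + skern r x' y).
Proof.
move=> M0 vM Sx Sx' xx' xi y'E.
have [Sy|Sy] := pselect (sphere R d y); last first.
  by rewrite !skern_out// subrr addr0 !mulr0.
have u0 : x - x' != 0 by rewrite subr_eq0.
have Sy' : sphere R d y' by rewrite y'E; apply/sphere_mulmx => //; exact: reflection_orthogonal.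
have uu : 0 < dot (x - x') (x - x') by rewrite lt_def dot_eq0 u0 dot_ge0.
have y'i : y' 0 i = y 0 i - 2 * dot y (x - x') / dot (x - x') (x - x') * (x 0 i - x' 0 i).
  by rewrite y'E reflectionE !mxE.
rewrite !skernE//.
have [yu|yu] := leP 0 (dot y (x - x')).
  have kk : kern r x' y <= kern r x y.
    by apply: kern_mono => //; [exact: ltW|rewrite -subr_ge0 -dotBl dotC].
  have := vM y y' Sy Sy'; rewrite y'i lerBlDr lerDl => /(_ _) vy.
  have {}vy : v y' - v y <= M.
    by apply: vy; rewrite !mulr_ge0 ?subr_ge0 ?invr_ge0 ?(ltW uu).
  (* The kernel takes the values 0 and 1: either the left side is 0, or the kernel values differ and
     it is the bounded difference of [v]. *)
  move: kk; rewrite /kern; case: ifP => _; case: ifP => _; nra.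
have kk : kern r x y <= kern r x' y.
  by apply: kern_mono => //; [exact: ltW|rewrite -subr_le0 -dotBl dotC ltW].
have := vM y' y Sy' Sy; rewrite y'i lerBrDr => vy.
have {}vy : v y - v y' <= M.
  apply: vy; rewrite gerDl mulr_le0_ge0 ?subr_ge0//.
  by rewrite mulr_le0_ge0 ?invr_ge0 ?(ltW uu)// mulr_ge0_le0 ?ltW.
move: kk; rewrite /kern; case: ifP => _; case: ifP => _; nra.
Qed.

Lemma avg_reflection (M : R) (x x' : Rd R d) : 0 <= M ->
  (forall z z', sphere R d z -> sphere R d z' -> z' 0 i <= z 0 i ->
     v z' - v z <= M) ->
  sphere R d x -> sphere R d x' -> x != x' -> x' 0 i <= x 0 i ->
  degree x' = degree x /\ avg x' - avg x <= M * degree x.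
Proof.
move=> M0 vM Sx Sx' xx' xi.
have u0 : x - x' != 0 by rewrite subr_eq0.
set Q := reflection (x - x').
have QQ : Q *m Q^T = 1%:M by exact: reflection_orthogonal.
have xQ : x *m Q = x'.
  by apply: reflection_swap => //; rewrite !(sphereP _).1.
have x'Q : x' *m Q = x by rewrite -xQ reflectionK.
have degE : degree x' = degree x by rewrite -xQ degree_mulmx.
split=> //.
have [g gE] : exists g : Rd R d -> R,
    g = (fun y => v y * skern r x' y - v y * skern r x y) by eexists.
have mg : measurable_fun setT g.
  by rewrite gE; apply: measurable_funB; exact: measurable_vskern.
have g2 y : `|g y| <= 2.
  rewrite gE; apply: le_trans (ler_normB _ _) _.
  by apply: lerD; exact: normr_vskern.
have ig : mu.-integrable setT (EFin \o g) := bounded_integrable _ _ _ mg g2.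
have igQ : mu.-integrable setT (EFin \o (fun y : Rd R d => g (y *m Q))).
  apply: (bounded_integrable mu _ 2) => [|y]; last exact: g2.
  exact: (measurableT_comp mg (measurable_mulmx Q)).
have Ig : avg x' - avg x = Rintegral mu setT g by rewrite gE -RintegralB.
have ik : mu.-integrable setT (EFin \o (fun y => skern r x y + skern r x' y)).
  exact: (integrableD _ (int_skern x) (int_skern x')).
(* [Q] swaps the two kernels, so this sum is the left side of [two_point]; by invariance its
   integral is twice that of [g]. *)
have gg y : g y + g (y *m Q) <= M * (skern r x y + skern r x' y).
  apply: le_trans (two_point M x x' y (y *m Q) M0 vM Sx Sx' xx' xi erefl).
  rewrite gE.
  have -> : skern r x' (y *m Q) = skern r x y by rewrite -xQ skern_mulmx.
  have -> : skern r x (y *m Q) = skern r x' y by rewrite -[in LHS]x'Q skern_mulmx.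
  by rewrite le_eqVlt; apply/orP; left; apply/eqP; ring.
have := le_Rintegral measurableT (integrableD measurableT ig igQ)
  (integrableZl measurableT M ik) (fun y _ => gg y).
rewrite (RintegralD measurableT ig igQ) (RintegralZl _ measurableT ik).
rewrite (RintegralD measurableT (int_skern x) (int_skern x')).
rewrite (Rintegral_mulmx _ mu_uniform _ _ _ QQ mg g2).
rewrite -/(degree x) -/(degree x') degE -Ig -!mulr2n mulrnAr.
by rewrite lerMn2r.
Qed.

(** Outside the landmark ball the gain is [degree x / (rho + degree x)], at most [1 / (1 + rho)]
    because [degree x <= 1]. A factor independent of the points survives the passage to the
    supremum. *)
Lemma monotone_step (M : R) (x x' : Rd R d) : 0 <= M ->
  (forall z z', sphere R d z -> sphere R d z' -> z' 0 i <= z 0 i ->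
     v z' - v z <= M) ->
  sphere R d x -> sphere R d x' -> x' 0 i <= x 0 i ->
  v x' - v x <= M / (1 + rho).
Proof.
move=> M0 vM Sx Sx' xi.
have M0' : 0 <= M / (1 + rho) by rewrite divr_ge0// addr_ge0// ltW.
have [->|xx'] := eqVneq x x'; first by rewrite subrr.
have [Mx|Mx] := pselect (Ms r i x).
  rewrite (v1 _ Mx); apply: le_trans M0'; rewrite subr_le0.
  by have /andP[] := v01 _ Sx'.
have Mx' : ~ Ms r i x'.
  move=> /(MsE _ _ _ (ltW r0))[_ h]; apply: Mx.
  by apply/(MsE _ _ _ (ltW r0)); split=> //; lra.
have [degE le] := avg_reflection M x x' M0 vM Sx Sx' xx' xi.
rewrite (landmark_eq _ Sx Mx) (landmark_eq _ Sx' Mx') degE -mulrBl.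
rewrite ler_pdivrMr ?ltr_wpDr// mulrAC ler_pdivlMr ?addr_gt0//.
have := degree_le1 x; have := degree_ge0 x => D0 D1.
have : (avg x' - avg x) * (1 + rho) <= M * degree x * (1 + rho).
  by rewrite ler_wpM2r// addr_ge0// ltW.
have : 0 <= M * rho * (1 - degree x) by rewrite !mulr_ge0 ?subr_ge0// ltW.
by lra.
Qed.

(** [sup E] is itself an admissible [M], nonnegative thanks to the pair [(x, x)]. So
    [sup E <= sup E / (1 + rho)], which forces [sup E <= 0]. *)
Lemma landmark_monotone (x x' : Rd R d) :
  sphere R d x -> sphere R d x' -> x' 0 i <= x 0 i -> v x' <= v x.
Proof.
move=> Sx Sx' xi.
pose E := [set a | exists z z' : Rd R d,
  [/\ sphere R d z, sphere R d z', z' 0 i <= z 0 i & a = v z' - v z]].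
have E0 : E 0 by exists x, x; rewrite subrr.
have supE : has_sup E.
  split; first by exists 0.
  exists 1 => _ [z [z' [Sz Sz' _ ->]]].
  by have /andP[? ?] := v01 _ Sz; have /andP[? ?] := v01 _ Sz'; lra.
have Ele z z' : sphere R d z -> sphere R d z' -> z' 0 i <= z 0 i ->
    v z' - v z <= sup E.
  by move=> Sz Sz' zi; apply: sup_upper_bound => //; exists z, z'.
have M0 : 0 <= sup E by exact: sup_upper_bound.
have : sup E <= sup E / (1 + rho).
  apply: ge_sup; first by exists 0.
  by move=> _ [z [z' [Sz Sz' zi ->]]]; exact: monotone_step.
rewrite ler_pdivlMr ?addr_gt0// mulrDr mulr1 gerDl pmulr_lle0// => supE0.
by rewrite -subr_le0; apply: le_trans supE0; exact: Ele.
Qed.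

(** * Positivity and strict decrease across a height gap *)

Hypothesis r1 : r < 1.
Context (j : 'I_d).
Hypothesis ij : j != i.

Lemma landmark_gt0 (x : Rd R d) : sphere R d x -> 0 < v x.
Proof.
move=> Sx; have /andP[vx0 _] := v01 _ Sx.
rewrite lt_neqAle vx0 andbT eq_sym; apply/eqP => {}vx0.
pose E := [set a | exists2 z : Rd R d, sphere R d z & v z = 0 /\ a = z 0 i].
have supE : has_sup E.
  split; first by exists (x 0 i), x.
  by exists 1 => _ [z Sz [_ ->]]; have /andP[] := coord_sphere_itv z i Sz.
(* By [parallel_point_dist], a rise of [2 * dl] moves the point by at most the square root of
   [8 * dl], which is [r / 2]. *)
pose dl := r ^+ 2 / 32.
have dl0 : 0 < dl by rewrite divr_gt0// exprn_gt0.
(* A zero within [dl] of the highest level: a zero at height [a + dl] will be a contradiction. *)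
have [_ [z Sz [vz ->]]] := sup_adherent dl0 supE.
set a := z 0 i; rewrite ltrBlDr => supa.
have [a1 a2] : -1 <= a /\ a <= 1 by apply/andP; exact: coord_sphere_itv.
have notMs y : v y = 0 -> ~ Ms r i y.
  by move=> vy /v1; rewrite vy => /eqP; rewrite eq_sym oner_eq0.
have ar : r ^+ 2 < 2 - 2 * a.
  rewrite ltNge; apply/negP => h; apply: (notMs z vz).
  by apply/(MsE _ _ _ (ltW r0)).
have dlE : 32 * dl = r ^+ 2 by rewrite /dl; lra.
have Sp t : a <= t -> t <= a + 2 * dl -> sphere R d (parallel_point i j t).
  by move=> at_ ta; apply: (sphere_parallel_point _ _ ij); apply/andP; split; lra.
(* [y] is a zero at the level of [z]. The [dl]-ball around [p] stays at or above the level of [q]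
   and inside the [r]-ball around [y]. *)
set y := parallel_point i j a; set p := parallel_point i j (a + 2 * dl).
set q := parallel_point i j (a + dl).
have Sy : sphere R d y by apply: Sp; lra.
have Sp' : sphere R d p by apply: Sp; lra.
have Sq : sphere R d q by apply: Sp; lra.
have vy : v y = 0.
  apply/eqP; rewrite eq_le; have /andP[-> _] := v01 _ Sy; rewrite andbT -vz.
  by apply: landmark_monotone => //; rewrite (parallel_point_coord _ _ ij).
pose B := sphere R d `&` [set w : Rd R d | enorm (p - w) <= dl].
have mB : measurable B.
  by apply: measurableI; [exact: measurable_sphere|exact: measurable_eball].
have muB : (0 < mu B)%E by exact: cap_gt0.
have yp : enorm (y - p) <= r / 2.
  rewrite -(ler_pXn2r (ltn0Sn 1)) ?nnegrE ?enorm_ge0 ?divr_ge0 ?(ltW r0)//.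
  have hd : 4 * (a + 2 * dl - a) <= (r / 2) ^+ 2 by rewrite expr_div_n -dlE; lra.
  by apply: le_trans hd; apply: (parallel_point_dist _ _ ij); lra.
have dlr : dl <= r / 2.
  have : r ^+ 2 <= r by rewrite expr2 ler_piMl ?(ltW r0) ?(ltW r1).
  by lra.
have Bq w : B w -> v q <= v w /\ skern r y w = 1.
  move=> [Sw /= pw]; split.
    apply: landmark_monotone => //; rewrite (parallel_point_coord _ _ ij).
    have := le_trans (coord_le_enorm (p - w) i) pw.
    rewrite coordB (parallel_point_coord _ _ ij) ler_norml => /andP[? ?]; lra.
  rewrite skernE// /kern ifT// -(subrK p y) -addrA.
  by rewrite (le_trans (enorm_triangle _ _))//; lra.
have avg0 : Rintegral mu setT (fun w => v w * skern r y w) = 0.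
  have := landmark_eq y Sy (notMs y vy); rewrite vy => /esym/eqP.
  rewrite mulf_eq0 invr_eq0 => /orP[/eqP//|].
  by rewrite gt_eqF// ltr_wpDr// Rintegral_ge0// => w _; exact: skern_ge0.
have vq0 : v q = 0.
  have /andP[vq0 vq1] := v01 _ Sq.
  apply/eqP; rewrite eq_le vq0 andbT.
  (* On [B] the integrand of [avg0] is at least [v q], and elsewhere it is nonnegative; [mu B > 0]
     then forces [v q = 0]. *)
  have : Rintegral mu B (fun=> v q) <= 0.
    rewrite -avg0 Rintegral_mkcond; apply: le_Rintegral => //.
      apply: (bounded_integrable mu _ 1).
        by apply/(measurable_restrictT _ mB).
      move=> w; rewrite patchE; case: ifP => _; last by rewrite normr0.
      by rewrite ger0_norm.
    move=> w _; rewrite patchE; case: ifPn => [/set_mem Bw|_].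
      by have [vqw ->] := Bq w Bw; rewrite mulr1.
    have [Sw|Sw] := pselect (sphere R d w); last by rewrite skern_out ?mulr0.
    by rewrite mulr_ge0 ?skern_ge0//; have /andP[] := v01 _ Sw.
  rewrite Rintegral_cst// pmulr_lle0// fine_gt0// muB/=.
  by rewrite -ge0_fin_numE// fin_num_measure.
have : a + dl <= sup E.
  by apply: sup_upper_bound => //; exists q => //; rewrite (parallel_point_coord _ _ ij).
by lra.
Qed.

Lemma landmark_gap (x x' : Rd R d) : sphere R d x -> sphere R d x' ->
  x' 0 i + r < x 0 i -> v x' < v x.
Proof.
move=> Sx Sx' xi.
have [x1 x2] : -1 <= x 0 i /\ x 0 i <= 1 by apply/andP; exact: coord_sphere_itv.
have rr : r ^+ 2 <= r by rewrite expr2 ler_piMl ?(ltW r0) ?(ltW r1).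
(* Otherwise [x' 0 i >= 1 - r / 2], and [x 0 i] would exceed 1. *)
have Mx' : ~ Ms r i x'.
  move=> /(MsE _ _ _ (ltW r0))[_ h].
  suff : r < 0 by rewrite ltNge (ltW r0).
  by lra.
have D0 : 0 <= Rintegral mu setT (skern r x').
  by apply: Rintegral_ge0 => y _; exact: skern_ge0.
have vx := landmark_gt0 _ Sx.
rewrite (landmark_eq _ Sx' Mx') ltr_pdivrMr; last exact: ltr_wpDr.
(* Strictness comes from the remaining term [v x * rho], positive by [landmark_gt0]. *)
apply: (@le_lt_trans _ _ (v x * Rintegral mu setT (skern r x'))); last first.
  by rewrite ltr_pM2l// ltrDr.
rewrite -(RintegralZl _ measurableT (int_skern x')); apply: le_Rintegral => //.
  exact: (integrableZl _ (v x) (int_skern x')).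
move=> y _; have [Sy|Sy] := pselect (sphere R d y); last first.
  by rewrite skern_out// !mulr0.
rewrite skernE// /kern; case: ifP => xy; last by rewrite !mulr0.
rewrite !mulr1; apply: landmark_monotone => //.
have := le_trans (coord_le_enorm (x' - y) i) xy.
by rewrite !mxE ler_norml => /andP[? ?]; lra.
Qed.

End landmark.

Theorem theorem5 (R : realType) (d : nat) (r rho : R)
  (mu : probability (Rd R d) R) (v : 'I_d -> Rd R d -> R) :
  (2 <= d)%N -> 0 < r -> r < 1 -> 0 < rho ->
  uniform_sphere mu ->
  (forall i, measurable_fun (sphere R d) (v i)) ->
  (forall i x, sphere R d x -> 0 <= v i x <= 1) ->
  (forall i x, Ms r i x -> v i x = 1) ->
  (forall i x, sphere R d x -> ~ Ms r i x ->
     v i x =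
       (Rintegral mu (Ms r i) (fun y => kern r x y)
        + Rintegral mu (sphere R d `\` Ms r i) (fun y => v i y * kern r x y))
       / (rho + Rintegral mu (sphere R d) (fun y => kern r x y))) ->
  forall x x' : Rd R d, sphere R d x -> sphere R d x' ->
    enorm (x - x') > chord_angle r * Num.sqrt d%:R ->
    (\row_i v i x) != (\row_i v i x').
Proof.
move=> d2 r0 r1 rho0 mu_uniform mv v01 v1 veq x x' Sx Sx' far.
have gap i z z' : sphere R d z -> sphere R d z' -> z' 0 i + r < z 0 i ->
    v i z' < v i z.
  (* [d >= 2] provides the second axis of the meridian used for positivity. *)
  have [j ji] : exists j : 'I_d, j != i.
    have : (0 < #|predC1 i|)%N by rewrite cardC1 card_ord -subn1 subn_gt0.
    by case/card_gt0P => j; exists j.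
  exact: (landmark_gap mu r rho mu_uniform r0 rho0 i (v i)
    (mv i) (v01 i) (v1 i) (veq i) r1 j ji).
apply/negP => /eqP/rowP vE.
suff : enorm (x - x') <= chord_angle r * Num.sqrt d%:R by rewrite leNgt far.
apply: enorm_le_coord => i; apply: le_trans (chord_angle_ge _ r0 r1).
have {}vE : v i x = v i x' by have := vE i; rewrite !mxE.
rewrite coordB ler_norml; apply/andP; split; rewrite leNgt; apply/negP => h.
  by have := gap i x' x Sx' Sx; rewrite vE ltxx => /(_ ltac:(lra)).
by have := gap i x x' Sx Sx'; rewrite vE ltxx => /(_ ltac:(lra)).
Qed.
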